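(* For every integer $m\ge 0$, $$A(f_m)=\frac{m-3}{5}f_{m+2}+\frac{m-1}{5}f_{m}+m+3 .$$
   Context: The Fibonacci sequence $\mathbb{F}$ is the infinite word over $\{a,b\}$ that is the fixed point beginning with $a$ of the morphism $\sigma(a)=ab$, $\sigma(b)=a$; positions are numbered from $1$, and $\mathbb{F}[1,n]$ is its prefix of length $n$. The numbers $f_m$ are given by $f_{-2}=0$, $f_{-1}=1$, $f_m=f_{m-1}+f_{m-2}$ for $m\ge 0$ (so $f_0=1,f_1=2,f_2=3,f_3=5$). $\mathcal{P}_F$ is the set of nonempty palindromes occurring as factors (finite contiguous subwords) of $\mathbb{F}$. For a factor $\omega$ of $\mathbb{F}$ and $p\ge1$, $\omega_p$ denotes the $p$-th occurrence of $\omega$ in $\mathbb{F}$ (every factor occurs infinitely often; occurrences may overlap and are ordered by position). $A(n)$ is the number of pairs $(\omega,p)$ with $\omega\in\mathcal{P}_F$, $p\ge1$, such that the occurrence $\omega_p$ lies entirely inside $\mathbb{F}[1,n]$. *)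

(* Defs.v *)
From mathcomp Require Import all_boot finmap.
From mathcomp Require Import boolp classical_sets functions cardinality.

Set Implicit Arguments.
Unset Strict Implicit.
Unset Printing Implicit Defensive.

Local Open Scope classical_set_scope.
Local Open Scope nat_scope.

Definition letter := bool.
Definition La : letter := true.
Definition Lb : letter := false.

Definition sigma_letter (x : letter) : seq letter :=
  if x == La then [:: La; Lb] else [:: La].

Definition sigma (w : seq letter) : seq letter := flatten (map sigma_letter w).

(* An infinite word is a function [u : nat -> letter]; the letter at position
   k >= 1 in the usual numbering is [u k.-1]. *)

(* sigma u = u: as sigma is non-erasing, it is enough that the image of each
   prefix of u is the prefix of u of the same length. *)
Definition sigma_fixed (u : nat -> letter) : Prop :=
  forall n, sigma (mkseq u n) = mkseq u (size (sigma (mkseq u n))).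

(* The limit of the words sigma^i(a); [fib_word_fixed] and [fib_word_unique]
   show that it is the unique fixed point of sigma beginning with a. *)
Definition fib_word (i : nat) : letter := nth La (iter i sigma [:: La]) i.

(* [fib m] is f_m for m >= 0; [fib_shift k] is f_(k-2). *)
Fixpoint fib_shift (k : nat) : nat :=
  match k with
  | 0 => 0
  | k'.+1 => if k' is k''.+1 then fib_shift k' + fib_shift k'' else 1
  end.

Definition fib (m : nat) : nat := fib_shift m.+2.

Definition occurs_at (w : seq letter) (i : nat) : bool :=
  mkseq (fun k => fib_word (i + k)) (size w) == w.

Definition is_factor (w : seq letter) : Prop := exists i, occurs_at w i.

Definition PF : set (seq letter) :=
  [set w | [/\ w <> [::], rev w = w & is_factor w]].

(* The p-th occurrence of w (p >= 1) starts at the 0-based index i. *)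
Definition nth_occurrence (w : seq letter) (p i : nat) : Prop :=
  occurs_at w i /\ count (occurs_at w) (iota 0 i.+1) = p.

Definition occ_pairs (n : nat) : set (seq letter * nat) :=
  [set wp | [/\ PF wp.1, 1 <= wp.2 &
     exists i, nth_occurrence wp.1 wp.2 i /\ i + size wp.1 <= n]].

(* [fset_set] is only meaningful on finite sets: see [finite_occ_pairs]. *)
Definition A (n : nat) : nat := #|` fset_set (occ_pairs n)|%fset.

Lemma finite_occ_pairs n : finite_set (occ_pairs n).
Proof.
pose g (x : (nat * nat) * nat) :=
  (mkseq (fun k => fib_word (x.1.1 + k)) x.1.2, x.2).
have fin : finite_set (g @` ((`I_n.+1 `*` `I_n.+1) `*` `I_n.+2)).
  by apply: finite_image; apply: finite_setX;
    [apply: finite_setX|]; exact: finite_II.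
apply: sub_finite_set fin => -[w p] [/= [w0 _ _] _ [i [[/eqP occ cnt] le]]].
exists ((i, size w), p); last by rewrite /g /= occ.
have lt_i : i <= n by apply: leq_trans le; exact: leq_addr.
split; first by split; rewrite /= ltnS // (leq_trans _ le) ?leq_addl.
rewrite /= -cnt ltnS (leq_trans (count_size _ _)) // size_iota.
by rewrite ltnS.
Qed.

Lemma sigma_cat v w : sigma (v ++ w) = sigma v ++ sigma w.
Proof. by rewrite /sigma map_cat flatten_cat. Qed.

Lemma size_sigma w : size w <= size (sigma w).
Proof. by elim: w => // -[] w IH; rewrite /sigma /= ltnS // leqW. Qed.

Lemma iter_sigma_rec k :
  exists w, iter k.+1 sigma [:: La] = iter k sigma [:: La] ++ w /\ w <> [::].
Proof.
elim: k => [|k [w [IH w0]]]; first by exists [:: Lb].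
exists (sigma w); split; first by rewrite iterS {1}IH sigma_cat.
by move=> s0; apply: w0; apply/nilP; rewrite /nilp -leqn0 (leq_trans (size_sigma w)) ?s0.
Qed.

Lemma iter_sigma_size k : k < size (iter k sigma [:: La]).
Proof.
elim: k => // k IH; have [w [-> w0]] := iter_sigma_rec k.
rewrite size_cat; case: w w0 => // x w _.
by rewrite /= addnS ltnS (leq_trans IH) // leq_addr.
Qed.

Lemma iter_sigma_prefix k d :
  exists w, iter (d + k) sigma [:: La] = iter k sigma [:: La] ++ w.
Proof.
elim: d => [|d [w IH]]; first by exists [::]; rewrite cats0.
have [v [-> _]] := iter_sigma_rec (d + k).
by exists (w ++ v); rewrite IH catA.
Qed.

Lemma fib_word_iter k i :
  i < size (iter k sigma [:: La]) -> fib_word i = nth La (iter k sigma [:: La]) i.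
Proof.
move=> ik; rewrite /fib_word; have [le|/ltnW le] := leqP i k.
  have [w] := iter_sigma_prefix i (k - i).
  by rewrite subnK // => ->; rewrite nth_cat iter_sigma_size.
have [w] := iter_sigma_prefix k (i - k).
by rewrite subnK // => ->; rewrite nth_cat ik.
Qed.

Lemma mkseq_fib_word k n :
  n <= size (iter k sigma [:: La]) ->
  mkseq fib_word n = take n (iter k sigma [:: La]).
Proof.
move=> le; apply: (@eq_from_nth _ La); first by rewrite size_mkseq size_takel.
move=> i; rewrite size_mkseq => lt_i.
by rewrite nth_mkseq // nth_take // (@fib_word_iter k) // (leq_trans lt_i).
Qed.

Lemma fib_word0 : fib_word 0 = La.
Proof. by []. Qed.

Lemma fib_word_fixed : sigma_fixed fib_word.
Proof.
move=> n; set s := iter n sigma [:: La].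
have le : n <= size s by exact: ltnW (iter_sigma_size n).
have e : iter n.+1 sigma [:: La] = sigma (take n s) ++ sigma (drop n s).
  by rewrite -sigma_cat cat_take_drop.
rewrite (mkseq_fib_word le) (@mkseq_fib_word n.+1) -/s e ?size_cat ?leq_addr //.
by rewrite take_size_cat.
Qed.

Lemma fib_word_unique u : u 0 = La -> sigma_fixed u -> u =1 fib_word.
Proof.
move=> u0 fixu i.
have H k : iter k sigma [:: La] = mkseq u (size (iter k sigma [:: La])).
  elim: k => [|k IH]; first by rewrite /mkseq /= u0.
  by rewrite iterS {1}IH fixu -IH.
by rewrite /fib_word H nth_mkseq // iter_sigma_size.
Qed.

(* Main.v *)
(* A palindrome w is sent by sigma to the palindrome sigma(w)a, and every
   palindrome bounded by a arises this way, from a unique interval of positions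
   (the empty w giving a itself); a palindrome bounded by b extends by a on both
   sides.  With E(j) the number of palindromic factors ending at position j, and
   s(j) the length of the image of the prefix of length j, this gives
   E(s(j) + 1) = E(j) + 1, and E(s(j) + 2) = E(j + 1) when letter j + 1 is a.
   Since A(n) = E(1) + ... + E(n) and s(f_m) = f_(m+1), summing gives
   A(f_(m+2)) = A(f_(m+1)) + A(f_m) + f_(m+2) - E(f_(m+1)) - E(f_m), and the
   same two rules give E(f_m) = floor(m/2) + 1, so that the last two terms
   subtract m + 2. *)
Require Import Defs.
From mathcomp Require Import all_boot all_order all_algebra finmap.
From mathcomp Require Import classical_sets cardinality.
From mathcomp Require Import zify ring.

Local Open Scope nat_scope.

(** * Palindromic factors as intervals of positions *)

Definition factor (i l : nat) : seq letter := mkseq (fun k => fib_word (i + k)) l.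

(** Intervals are half-open and 0-based, so [j] is the length of the shortest prefix containing the
    factor. *)
Definition pal (i j : nat) : bool := rev (factor i (j - i)) == factor i (j - i).

Definition pals_ending (j : nat) : nat := \sum_(0 <= i < j) pal i j.

(* The position in the fixed point at which the image of letter n starts. *)
Definition sigma_pos (n : nat) : nat := size (sigma (mkseq fib_word n)).

Lemma factor_cat i l k : factor i (l + k) = factor i l ++ factor (i + l) k.
Proof.
rewrite /factor /mkseq iotaD map_cat add0n.
have := iotaDl l 0 k; rewrite addn0 => ->; rewrite -map_comp.
by congr (_ ++ _); apply: eq_map => x /=; rewrite addnA.
Qed.

Lemma factor1 i : factor i 1 = [:: fib_word i].
Proof. by rewrite /factor /mkseq /= addn0. Qed.

Lemma factor_consrcons i l :
  factor i l.+2 = fib_word i :: rcons (factor i.+1 l) (fib_word (i + l.+1)).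
Proof.
have -> : l.+2 = 1 + l + 1 by rewrite add1n addn1.
by rewrite (factor_cat i (1 + l) 1) (factor_cat i 1 l) !factor1 addn1 cats1 add1n.
Qed.

Lemma pal_succ i : pal i i.+1.
Proof. by rewrite /pal subSnn factor1. Qed.

Lemma pal_wrap i j : i < j ->
  pal i j.+1 = (fib_word i == fib_word j) && pal i.+1 j.
Proof.
move=> lt_ij; rewrite /pal; have -> : j.+1 - i = (j - i.+1).+2 by lia.
rewrite factor_consrcons; have -> : i + (j - i.+1).+1 = j by lia.
rewrite rev_cons rev_rcons /= eqseq_cons eqseq_rcons (eq_sym (fib_word j)).
by case: (_ == fib_word j); rewrite ?andbT ?andbF.
Qed.

Lemma pal_ends i j : i <= j -> pal i j.+1 -> fib_word i = fib_word j.
Proof.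
rewrite leq_eqVlt => /orP[/eqP -> //|lt_ij].
by rewrite pal_wrap // => /andP[/eqP].
Qed.

(** * The morphism and its blocks *)

Lemma sigma_inj : injective sigma.
Proof.
elim=> [|x v IH] [|y w] //; first by case: y.
  by case: x.
(* A nonempty image begins with a, so a leading a is followed by b exactly when it comes from
   sigma(a). *)
case: x y => [] [] //.
- by move=> [] /IH ->.
- by case: w => [|[] w].
- by case: v {IH} => [|[] v].
- by move=> [] /IH ->.
Qed.

(** For a single letter x, a rev(sigma(x)) = sigma(x) a; the extra a thus moves through [w] letter
    by letter. *)
Lemma rev_sigma w : La :: rev (sigma w) = rcons (sigma (rev w)) La.
Proof.
elim: w => // x w IH; rewrite -[x :: w]cat1s sigma_cat rev_cat -cat_cons IH.
rewrite cat1s rev_cons -!cats1 sigma_cat -!catA.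
by case: x.
Qed.

(** A letter coerces to 1 for a and 0 for b, so its successor is the length of its image. *)
Lemma sigma_posS n : sigma_pos n.+1 = sigma_pos n + (fib_word n).+1.
Proof.
rewrite /sigma_pos -addn1 /mkseq iotaD map_cat sigma_cat size_cat add0n /=.
by case: fib_word.
Qed.

Lemma sigma_pos_le i j : i <= j -> sigma_pos i <= sigma_pos j.
Proof.
move=> /subnKC <-; elim: (j - i) => [|l IH]; rewrite ?addn0 //.
by rewrite addnS sigma_posS (leq_trans IH) ?leq_addr.
Qed.

(** The images of the prefixes of lengths [i] and [i + l] are again prefixes of the fixed point;
    cancel the shorter one. *)
Lemma factor_sigma i l :
  factor (sigma_pos i) (sigma_pos (i + l) - sigma_pos i) = sigma (factor i l).
Proof.
have fix_ n : sigma (factor 0 n) = factor 0 (sigma_pos n) by exact: fib_word_fixed.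
have le : sigma_pos i <= sigma_pos (i + l) by rewrite sigma_pos_le ?leq_addr.
have /eqP := fix_ (i + l).
rewrite factor_cat sigma_cat fix_ -[X in _ == factor 0 X](subnKC le) factor_cat.
by rewrite eqseq_cat // !add0n => /andP[_ /eqP ->].
Qed.

Lemma fib_word_block n :
  fib_word (sigma_pos n) = La /\
  (fib_word n = La -> fib_word (sigma_pos n).+1 = Lb).
Proof.
have := factor_sigma n 1; rewrite addn1 sigma_posS addKn.
rewrite -(addn1 (fib_word n)) addnC factor_cat !factor1.
by case: (fib_word n); rewrite ?factor1 ?addn1 => -[-> //].
Qed.

Lemma fib_word_sigma_pos n : fib_word (sigma_pos n) = La.
Proof. by have [] := fib_word_block n. Qed.

Lemma fib_word_sigma_posS n :
  fib_word n = La -> fib_word (sigma_pos n).+1 = Lb.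
Proof. by have [] := fib_word_block n. Qed.

(** * Palindromes under the morphism *)

Lemma pal_sigma i j : i <= j -> pal (sigma_pos i) (sigma_pos j).+1 = pal i j.
Proof.
move=> le_ij; rewrite /pal subSn ?sigma_pos_le // -addn1 factor_cat.
rewrite subnKC ?sigma_pos_le // factor1 fib_word_sigma_pos.
have := factor_sigma i (j - i); rewrite subnKC // => ->.
rewrite rev_cat /= rev_sigma cats1 eqseq_rcons eqxx andbT.
by rewrite (inj_eq sigma_inj).
Qed.

Lemma sum_sigma_pos (G : nat -> nat) n :
  \sum_(0 <= i < sigma_pos n) G i =
  \sum_(0 <= i < n) (G (sigma_pos i) + fib_word i * G (sigma_pos i).+1).
Proof.
elim: n => [|n IH]; first by rewrite !big_geq.
rewrite [RHS]big_nat_recr //= -IH sigma_posS.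
by case: fib_word; rewrite ?addn2 ?addn1 !big_nat_recr //= ?mul1n ?addn0 ?addnA.
Qed.

Lemma pals_ending_a j : pals_ending (sigma_pos j).+1 = (pals_ending j).+1.
Proof.
(* The extra palindrome is the single letter at [sigma_pos j]. *)
rewrite /pals_ending big_nat_recr //= pal_succ addn1; congr _.+1.
rewrite sum_sigma_pos; apply: eq_big_nat => i /andP[_ lt_ij].
rewrite pal_sigma 1?ltnW //; case Ei: (fib_word i); last by rewrite addn0.
(* Such a factor would begin with b and end with a. *)
case P: (pal (sigma_pos i).+1 _); last by rewrite addn0.
have le : (sigma_pos i).+1 <= sigma_pos j.
  by have := sigma_pos_le _ _ lt_ij; rewrite sigma_posS Ei; lia.
by have := pal_ends _ _ le P; rewrite fib_word_sigma_pos fib_word_sigma_posS.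
Qed.

Lemma pals_ending_b j : fib_word j = La ->
  pals_ending (sigma_pos j).+2 = pals_ending j.+1.
Proof.
move=> Ej.
have sjS : (sigma_pos j).+2 = sigma_pos j.+1 by rewrite sigma_posS Ej addn2.
rewrite /pals_ending {1}sjS sum_sigma_pos; apply: eq_big_nat => i /andP[_ lt_ij].
have le : sigma_pos i <= sigma_pos j by exact: sigma_pos_le.
have -> : pal (sigma_pos i) (sigma_pos j).+2 = false.
  by apply/negP => /(pal_ends _ _ (leqW le)); rewrite fib_word_sigma_pos fib_word_sigma_posS.
(* [pal_sigma] gives an interval bounded by a on both sides; strip these two letters. *)
have wrap : pal i j.+1 = pal (sigma_pos i).+1 (sigma_pos j).+2.
  rewrite -pal_sigma 1?ltnW // -sjS pal_wrap ?ltnS ?leqW //.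
  by rewrite sjS !fib_word_sigma_pos.
rewrite -wrap; case Ei: (fib_word i); first by rewrite mul1n.
by case P: (pal i j.+1) => //; have := pal_ends i j lt_ij P; rewrite Ei Ej.
Qed.

Definition pals (n : nat) : nat := \sum_(0 <= j < n) pals_ending j.+1.

(** The a's among the first [sigma_pos k] letters are exactly the [k] block starts. Ends at second
    letters of blocks thus reduce, by [pals_ending_b] and then [pals_ending_a], to the prefix of
    length [k]. *)
Lemma pals_sigma_pos2 k :
  pals (sigma_pos (sigma_pos k)) + pals_ending (sigma_pos k) + pals_ending k =
  pals (sigma_pos k) + pals k + sigma_pos k + k.
Proof.
(* [pals n] runs over ends 1 to [n], this sum over 0 to [n - 1], and no palindrome ends at 0. *)
have shift n : \sum_(0 <= j < n) (pals_ending j).+1 + pals_ending n = pals n + n.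
  elim: n => [|n IH]; first by rewrite /pals /pals_ending !big_geq.
  rewrite /pals !big_nat_recr //= -/(pals n); lia.
have -> : pals (sigma_pos (sigma_pos k)) =
    \sum_(0 <= j < sigma_pos k) (pals_ending j).+1 +
    \sum_(0 <= j < k) (pals_ending j).+1.
  rewrite /pals sum_sigma_pos big_split /=; congr (_ + _).
    by apply: eq_bigr => j _; rewrite pals_ending_a.
  rewrite sum_sigma_pos; apply: eq_bigr => j _.
  rewrite fib_word_sigma_pos mul1n pals_ending_b ?fib_word_sigma_pos //.
  rewrite pals_ending_a; case Ej: (fib_word j); last by rewrite addn0.
  by rewrite fib_word_sigma_posS // mul0n muln0 addn0.
have := shift k; have := shift (sigma_pos k); lia.
Qed.

(** Each block contains exactly one a, so a second application of sigma lengthens it by one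
    letter. *)
Lemma sigma_pos2 n : sigma_pos (sigma_pos n) = sigma_pos n + n.
Proof.
have sE k : sigma_pos k = \sum_(0 <= i < k) (1 + fib_word i).
  elim: k => [|k IH]; first by rewrite big_geq.
  by rewrite sigma_posS big_nat_recr //= -IH.
transitivity (\sum_(0 <= i < n) (1 + fib_word i + 1)); last first.
  by rewrite big_split /= -sE sum_nat_const_nat subn0 muln1.
rewrite sE sum_sigma_pos; apply: eq_bigr => i _; rewrite fib_word_sigma_pos.
by case Ei: (fib_word i) => //; rewrite fib_word_sigma_posS.
Qed.

(** * Prefixes of Fibonacci length *)

Lemma fibSS m : fib m.+2 = fib m.+1 + fib m.
Proof. by []. Qed.

Lemma sigma_pos_fib m : sigma_pos (fib m) = fib m.+1.
Proof.
by elim: m => // m IH; rewrite -[in LHS]IH sigma_pos2 IH.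
Qed.

Lemma fib_gt0 m : 0 < fib m.
Proof. by elim: m => // m IH; rewrite -sigma_pos_fib; case: (fib m) IH. Qed.

(* The clause on [(fib m).-2] says that a final b is preceded by a,
   as needed to apply [pals_ending_b] at the last position. *)
Lemma pals_ending_fib m :
  [/\ fib_word (fib m).-1 = ~~ odd m, odd m -> fib_word (fib m).-2 = La,
      pals_ending (fib m) = m./2.+1 & pals_ending (fib m).-1 = uphalf m].
Proof.
have p0 : pals_ending 0 = 0 by rewrite /pals_ending big_geq.
elim: m => [|m]; first by rewrite /= p0 /pals_ending big_nat1.
rewrite -sigma_pos_fib; case: (fib m) (fib_gt0 m) => // n _ [Ew Ew1 IH1 IH2].
rewrite /= in Ew Ew1 IH2.
rewrite sigma_posS Ew; have := uphalf_half m.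
rewrite -[odd m.+1]/(~~ odd m).
case: (odd m) Ew Ew1 => Ew Ew1 Em; rewrite ?addn1 ?addn2 /=.
(* For odd [m] the prefix ends in ab and its image in aba; for even [m], below, in a and ab. *)
- case: n Ew {Ew1}(Ew1 isT) IH1 IH2 => [//|n] Ew Ew' IH1 IH2.
  have e : sigma_pos n.+1 = (sigma_pos n).+2 by rewrite sigma_posS Ew' addn2.
  rewrite pals_ending_a fib_word_sigma_pos IH2 e pals_ending_b // IH2.
  by split; rewrite ?Em.
- rewrite fib_word_sigma_pos fib_word_sigma_posS // pals_ending_b // pals_ending_a.
  by rewrite IH1 IH2 Em.
Qed.

Lemma pals_fib_rec m :
  pals (fib m.+2) + m.+2 = pals (fib m.+1) + pals (fib m) + fib m.+2.
Proof.
have := pals_sigma_pos2 (fib m); rewrite !sigma_pos_fib fibSS.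
have [_ _ -> _] := pals_ending_fib m; have [_ _ -> _] := pals_ending_fib m.+1.
have := odd_double_half m; have := uphalf_half m => /=; lia.
Qed.

(** * Numbered occurrences as intervals *)

Lemma occurs_atE w i : occurs_at w i = (w == factor i (size w)).
Proof. by rewrite /occurs_at eq_sym. Qed.

Definition occurrence (j i : nat) : seq letter * nat :=
  let w := factor i (j - i) in (w, count (occurs_at w) (iota 0 i.+1)).

(** The count strictly increases at every occurrence of the common word, so equal ranks force equal
    starts. *)
Lemma occurrence_inj j j' i i' : i <= j -> i' <= j' ->
  occurrence j i = occurrence j' i' -> i = i' /\ j = j'.
Proof.
move=> le le' e.
have ew : factor i (j - i) = factor i' (j' - i') := congr1 fst e.
have := congr1 snd e : count _ (iota 0 i.+1) = count _ (iota 0 i'.+1).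
have es : j - i = j' - i' by have := congr1 size ew; rewrite !size_mkseq.
rewrite /occurrence -ew; set w := factor i _ => ec.
have oi : occurs_at w i by rewrite occurs_atE size_mkseq.
have oi' : occurs_at w i' by rewrite occurs_atE /w ew size_mkseq.
have lt_count k l : k < l -> occurs_at w l ->
    count (occurs_at w) (iota 0 k.+1) < count (occurs_at w) (iota 0 l.+1).
  move=> lt_kl ol; rewrite -(addn1 l) iotaD count_cat /= ol addn0 addn1 ltnS.
  by rewrite -(subnKC lt_kl) iotaD count_cat leq_addr.
suff ei : i = i' by split=> //; lia.
have [lt|lt|//] := ltngtP i i'.
  by have := lt_count _ _ lt oi'; rewrite ec ltnn.
by have := lt_count _ _ lt oi; rewrite ec ltnn.
Qed.

Lemma A_pals n : A n = pals n.
Proof.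
set s := [seq occurrence j i | j <- iota 1 n, i <- [seq i <- iota 0 j | pal i j]].
have sz : size s = pals n.
  rewrite /s size_allpairs_dep /pals sumnE big_map.
  rewrite -[iota 1 n]/(iota (1 + 0) n) iotaDl big_map /index_iota subn0.
  apply: eq_bigr => j _.
  by rewrite size_filter /pals_ending /index_iota subn0 -sumn_count sumnE big_map.
have us : uniq s.
  apply: allpairs_uniq_dep; first exact: iota_uniq.
    by move=> j _; rewrite filter_uniq // iota_uniq.
  (* The filter supplies the [i <= j] that [occurrence_inj] requires, subtraction being
     truncated. *)
  have bound a : a \in [seq existT (fun=> nat) j i | j <- iota 1 n,
      i <- [seq i <- iota 0 j | pal i j]] -> tagged a <= tag a.
    move=> /allpairsPdep[j [i [_]]]; rewrite mem_filter mem_iota add0n.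
    move=> /andP[_ /andP[_ /ltnW le]] ->; exact: le.
  move=> [j i] [j' i'] /bound /= le /bound /= le' e.
  by have [-> ->] := occurrence_inj _ _ _ _ le le' e.
rewrite /A -sz; apply/perm_size/uniq_perm => //.
move=> [w p]; rewrite in_fset_set; last exact: finite_occ_pairs.
apply/idP/idP.
  rewrite inE => -[/= [w0 rw _] _ [i [[oi <-] le]]].
  apply/allpairsPdep; exists (i + size w), i; rewrite mem_iota mem_filter mem_iota.
  have sw : 0 < size w by case: w w0 {rw oi le}.
  have ew : factor i (size w) = w by apply/eqP; rewrite eq_sym -occurs_atE.
  split; rewrite /occurrence /pal ?addKn ?ew ?rw ?eqxx //; move: (size w) sw le => l; lia.
move=> /allpairsPdep[j [i []]]; rewrite mem_iota mem_filter mem_iota.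
move=> lej /andP[pij lij] [-> ->]; rewrite inE.
have oi : occurs_at (factor i (j - i)) i by rewrite occurs_atE size_mkseq.
split.
- split=> /=; [|exact/eqP|by exists i].
  by move=> /(congr1 size); rewrite size_mkseq /=; lia.
- change (0 < count (occurs_at (factor i (j - i))) (iota 0 i.+1)).
  by rewrite -has_count; apply/hasP; exists i; rewrite // mem_iota; lia.
- exists i; split; first by split.
  by rewrite /= size_mkseq; lia.
Qed.

Import GRing.Theory.
Local Open Scope ring_scope.

Theorem theorem4p4 (m : nat) :
  (A (fib m))%:R =
    (m%:R - 3%:R) / 5%:R * (fib m.+2)%:R + (m%:R - 1) / 5%:R * (fib m)%:R
      + m%:R + 3%:R :> rat.
Proof.
rewrite A_pals; elim/ltn_ind: m => -[|[|m]] IH.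
- by rewrite /pals big_nat1 /pals_ending big_nat1.
- by rewrite /pals /pals_ending !big_nat_recr // !big_geq.
have IH1 := IH m.+1 (ltnSn _); have IH0 := IH m (leqW (leqnn _)).
(* Casting to [rat] first lets the term [m.+2] be moved across by a true subtraction. *)
have := congr1 (fun k => k%:R : rat) (pals_fib_rec m).
rewrite !natrD IH1 IH0 => /(canRL (addrK _)) ->.
rewrite !fibSS !natrD -[m.+2]addn2 -[m.+1]addn1 !natrD.
by field.
Qed.
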